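(* Let $G$ be a locally compact Hausdorff topological group and $f:G\to\mathbb{C}$ a function. Then $f$ is a Bohr a.a. function on $G$ if and only if $f\in\mathrm{A}_c(G)$ (i.e., $f$ is a Bochner a.a. function on $G$).
   Context: For $f:G\to\mathbb{C}$ and $t\in G$ let $(ft)(x)=f(tx)$ and $(tf)(x)=f(xt)$. $\mathrm{LUC}(G)$ (resp. $\mathrm{RUC}(G)$) is the set of bounded continuous $f:G\to\mathbb{C}$ such that $ft_n\to ft$ (resp. $t_nf\to tf$) in the supremum norm whenever $t_n\to t$ in $G$; $\mathrm{UC}(G)=\mathrm{LUC}(G)\cap\mathrm{RUC}(G)$. Bochner a.a.: $f\in\mathrm{A}_{c,L}(G)$ if every net $\{t_n\}$ in $G$ has a subnet $\{t_{n'}\}$ and there is a continuous $\phi:G\to\mathbb{C}$ with $t_{n'}f\to\phi$ and $t_{n'}^{-1}\phi\to f$ pointwise; $f\in\mathrm{A}_{c,R}(G)$ is defined analogously with $ft_{n'}\to\phi$ and $\phi t_{n'}^{-1}\to f$ pointwise; $\mathrm{A}_c(G)=\mathrm{A}_{c,L}(G)\cap\mathrm{A}_{c,R}(G)$. A set $B\subseteq G$ is syndetic in $G$ if $G=K^{-1}B$ for some compact $K\subseteq G$. Bohr a.a.: $f$ is a Bohr a.a. function on $G$ if for each finite set $N\subset G$ and each real $\varepsilon>0$ there is a set $B=B(N,\varepsilon)\subseteq G$ such that: (a) $B$ is syndetic in $G$; (b) $B=B^{-1}$; (c) if $b\in B$, then $\max_{s,t\in N}|f(sbt)-f(st)|<\varepsilon$;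 (d) if $b_1,b_2\in B$, then $\max_{s,t\in N}|f(sb_1^{-1}b_2t)-f(st)|<2\varepsilon$; and moreover (e) $f\in\mathrm{UC}(G)$. *)

(* Defs.v *)
From HB Require Import structures.
From mathcomp Require Import all_boot all_order all_algebra.
From mathcomp Require Import all_classical all_reals all_analysis.
From mathcomp Require Import complex.

Set Implicit Arguments.
Unset Strict Implicit.
Unset Printing Implicit Defensive.

Import Order.TTheory GRing.Theory Num.Theory.
Import numFieldNormedType.Exports.

Local Open Scope classical_set_scope.
Local Open Scope ring_scope.
Local Open Scope complex_scope.

HB.mixin Record PreTopologicalGroup_isTopologicalGroup G
    of Group G & Topological G := {
  mulg_continuous : continuous (fun p : G * G => (p.1 * p.2)%g) ;
  invg_continuous : continuous (fun x : G => (x^-1)%g) }.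

#[short(type="topologicalGroupType")]
HB.structure Definition TopologicalGroup :=
  {G of Group G & Topological G & PreTopologicalGroup_isTopologicalGroup G}.

(* The regular type [R[i]^o] carries the topology given by the modulus. *)
Notation cplx R := (R[i]^o).

Record directedSet := DirectedSet {
  dir_sort :> Type ;
  dir_le : dir_sort -> dir_sort -> Prop ;
  dir_inhabited : inhabited dir_sort ;
  dir_refl : forall d, dir_le d d ;
  dir_trans : forall d e c, dir_le d e -> dir_le e c -> dir_le d c ;
  dir_upper : forall d e, exists c, dir_le d c /\ dir_le e c }.

(* The filter of eventual subsets of [D]: a net [t : D -> X] converges to [x]
   when [t @ tails D --> x]. *)
Definition tails (D : directedSet) : set_system D :=
  filter_from [set: D] (fun d => [set e | dir_le d e]).
Arguments tails : clear implicits.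

(* The net [t \o h], for [t : D -> X], is a subnet of [t]; the map [h] is not
   required to be monotone. *)
Definition is_subnet_map (D E : directedSet) (h : E -> D) : Prop :=
  forall d : D, exists e0 : E, forall e : E, dir_le e0 e -> dir_le d (h e).

Section AlmostAutomorphic.
Context {R : realType} {G : topologicalGroupType}.
Implicit Types (f : G -> cplx R) (t x : G).

(* [fmulg f t] is the function written $ft$, and [mulgf t f] is $tf$. *)
Definition fmulg f t : G -> cplx R := fun x => f (t * x)%g.
Definition mulgf t f : G -> cplx R := fun x => f (x * t)%g.

(* Extended-real valued, so that unbounded functions have norm [+oo]. *)
Definition supnorm f : \bar R :=
  ereal_sup (range (fun x => (Normc.normc (f x))%:E)).

Definition LUC f : Prop :=
  [/\ bounded_fun f, continuous f &
    forall (D : directedSet) (t : D -> G) (t0 : G), t @ tails D --> t0 ->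
      (fun n => supnorm (fmulg f (t n) \- fmulg f t0)) @ tails D --> 0%E].

Definition RUC f : Prop :=
  [/\ bounded_fun f, continuous f &
    forall (D : directedSet) (t : D -> G) (t0 : G), t @ tails D --> t0 ->
      (fun n => supnorm (mulgf (t n) f \- mulgf t0 f)) @ tails D --> 0%E].

Definition UC f : Prop := LUC f /\ RUC f.

Definition bochner_aaL f : Prop :=
  forall (D : directedSet) (t : D -> G),
  exists (E : directedSet) (h : E -> D) (phi : G -> cplx R),
  [/\ is_subnet_map h, continuous phi,
      forall x, (fun n => mulgf (t (h n)) f x) @ tails E --> phi x &
      forall x, (fun n => mulgf (t (h n))^-1%g phi x) @ tails E --> f x].

Definition bochner_aaR f : Prop :=
  forall (D : directedSet) (t : D -> G),
  exists (E : directedSet) (h : E -> D) (phi : G -> cplx R),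
  [/\ is_subnet_map h, continuous phi,
      forall x, (fun n => fmulg f (t (h n)) x) @ tails E --> phi x &
      forall x, (fun n => fmulg phi (t (h n))^-1%g x) @ tails E --> f x].

Definition bochner_aa f : Prop := bochner_aaL f /\ bochner_aaR f.

Definition syndetic (B : set G) : Prop :=
  exists2 K : set G, compact K &
    [set: G] = [set (k^-1 * b)%g | k in K & b in B].

Definition bohr_aa f : Prop :=
  (forall (N : set G) (eps : R), finite_set N -> 0 < eps ->
    exists B : set G,
    [/\ syndetic B,
        B = [set b^-1%g | b in B],
        (forall b, B b -> forall s t, N s -> N t ->
          `|f (s * b * t)%g - f (s * t)%g| < eps%:C) &
        (forall b1 b2, B b1 -> B b2 -> forall s t, N s -> N t ->
          `|f (s * b1^-1 * b2 * t)%g - f (s * t)%g| < (2 * eps)%:C)]) /\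
  UC f.

End AlmostAutomorphic.

(* Main.v *)
Require Import Defs.
From mathcomp Require Import all_boot all_order all_algebra.
From mathcomp Require Import all_classical all_reals all_analysis.
From mathcomp Require Import complex.
From mathcomp Require Import lra.

(** Call [x] a good return of [f] when [f (s x t)] and [f (s x^-1 t)] are close
    to [f (s t)] for all [s], [t] in a large finite set. Good returns generate a
    filter [returns f] on [G], which is stable under inversion, conjugation and
    products. Both notions of almost automorphy amount to one property of this
    filter: that it consists of the neighbourhoods of [1] for a precompact group
    topology on [G], i.e. that quotients [x^-1 y] of very good returns are good
    ([returns_divide]) and that finitely many left translates of any member
    cover [G] ([returns_precompact]).

    From Bohr to this property: the sets [B] only satisfy [G = K^-1 B = B K]
    with [K] compact depending on [B], and uniform continuity removes
    an error [u] near [1] from [f (s u z t)] or [f (s z u t)], but not from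
    [f (s b^-1 u c t)] with unbounded [b], [c]. From [G = K^-1 B] one gets
    precompactness ([bohr_returns_precompact]). From [G = B K] one gets a finite
    colouring of [G] such that [x^-1 y] is good up to conjugation by
    the colour whenever [x] and [y] have the same colour. A minimality argument
    on the sets of colours met near a point yields one colour that works
    for all very good returns, and conjugation by a fixed element
    does not matter ([colouring_divide]).

    From this property to Bochner ([precompact_ultra_aaL]): an ultrafilter [F]
    contains a translate [k W] of a member [W] of [returns f], and
    [x^-1 y] lies in [W^-1 W] for [x], [y] in [k W]; so the limit [phi] of
    [f (. y)] along [F] satisfies [phi (s x^-1)] close to [f s].

    From Bochner to this property: along any ultrafilter the iterated limit of
    [f (s x^-1 y t)] is [f (s t)] ([ultra_aaL_iterated]), which gives
    precompactness by compactness of the space of ultrafilters, and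
    [returns_divide] by applying it to a sequence of products of returns
    ([bochner_returns_divide]). A Bochner function is moreover uniformly
    continuous: this is an instance of joint continuity for separately
    continuous actions, obtained from a double limit argument
    ([small_oscillation]). From the property to Bohr there is little to do
    ([returns_bohr]).

    The right-hand notions for [f] are the left-hand notions for
    [f \o monoid.inv], and both functions have the same returns. *)

Set Implicit Arguments.
Unset Strict Implicit.
Unset Printing Implicit Defensive.

Import Order.TTheory GRing.Theory Num.Theory.
Import numFieldNormedType.Exports.

Local Open Scope classical_set_scope.
Local Open Scope ring_scope.
Local Open Scope complex_scope.

(** * Filters, ultrafilters and nets *)

Lemma filterI_ex (T : Type) (F : set_system T) {FF : ProperFilter F}
    (A B : set T) :
  F A -> F B -> exists x, A x /\ B x.
Proof.
by move=> FA FB; apply: (@filter_ex _ F FF (A `&` B)); exact: filterI.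
Qed.

Lemma near_seq (T : Type) (I : eqType) (F : set_system T) {FF : Filter F}
    (l : seq I) (P : I -> T -> Prop) :
  (forall i, i \in l -> \forall x \near F, P i x) ->
  \forall x \near F, forall i, i \in l -> P i x.
Proof.
elim: l => [|i l IH] FP.
  by apply: filterS filterT => x _ i; rewrite in_nil.
have Fi : \forall x \near F, P i x by apply: FP; rewrite mem_head.
have Fl : \forall x \near F, forall j, j \in l -> P j x.
  by apply: IH => j jl; apply: FP; rewrite in_cons jl orbT.
apply: filterS2 Fi Fl => x Pi Pl j; rewrite in_cons => /orP[/eqP->//|].
exact: Pl.
Qed.

(** Since [y] may be chosen after [x], this filter is finer than the product
    filter. *)
Definition iterated (T U : Type) (F : set_system T) (H : set_system U) :
  set_system (T * U) :=
  [set A | \forall x \near F, \forall y \near H, A (x, y)].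

Instance iterated_filter (T U : Type) (F : set_system T) (H : set_system U) :
  Filter F -> Filter H -> Filter (iterated F H).
Proof.
move=> FF FH; split; rewrite /iterated /=.
- by apply: (@filterS _ F _ setT) => [x _|]; exact: filterT.
- move=> A B; apply: (@filterS2 _ F) => x; exact: (@filterS2 _ H).
- move=> A B AB; apply: (@filterS _ F) => x; apply: (@filterS _ H) => y.
  exact: AB.
Qed.

Instance ultra_fmap (T U : Type) (f : T -> U) (F : set_system T) :
  UltraFilter F -> UltraFilter (f @ F).
Proof.
move=> FU; split=> [|H HH FH]; first exact: fmap_proper_filter.
rewrite eqEsubset; split=> // A HA.
have [//|FnA] := in_ultra_setVsetC (f @^-1` A) FU.
have HnA : H (~` A) by apply: FH.
by have [y []] := filterI_ex HA HnA.
Qed.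

(** The finite-subcover property of the compact space of ultrafilters. *)
Lemma ultra_finite_cover (T : Type) (I : eqType) (S : I -> set T) :
  (forall F : set_system T, UltraFilter F -> exists i, F (S i)) ->
  exists l : seq I, forall x, exists2 i, i \in l & S i x.
Proof.
move=> FS; apply: contrapT => nocover.
pose B (l : seq I) := [set x | forall i, i \in l -> ~ S i x].
have BF : Filter (filter_from [set: seq I] B).
  apply: filter_fromT_filter => [|l k]; first by exists [::].
  exists (l ++ k) => x Bx; split=> i il; apply: Bx; rewrite mem_cat il ?orbT //.
have BP : ProperFilter (filter_from [set: seq I] B).
  apply: filter_from_proper => l _; apply: contrapT => B0.
  apply: nocover; exists l => x; apply: contrapT => nSx.
  by apply: B0; exists x => i il Six; apply: nSx; exists i.
have [F [FU BsubF]] := ultraFilterLemma BP.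
have [i Fi] := FS F FU.
have FnS : F (B [:: i]) by apply: BsubF; exists [:: i].
have [x [Six /(_ i)]] := filterI_ex Fi FnS.
by rewrite mem_head => /(_ isT).
Qed.

Lemma ultra_finite_union (T : Type) (I : eqType) (S : I -> set T) (l : seq I)
    (F : set_system T) :
  UltraFilter F -> (forall x, exists2 i, i \in l & S i x) ->
  exists2 i, i \in l & F (S i).
Proof.
move=> FU cover; apply: contrapT => noS.
have : \forall x \near F, forall i, i \in l -> ~ S i x.
  apply: near_seq => i il; have [FS|//] := in_ultra_setVsetC (S i) FU.
  by exfalso; apply: noS; exists i.
move=> /filter_ex[x nSx]; have [i il Six] := cover x; exact: nSx Six.
Qed.

Lemma compact_ultra_cvg (T : topologicalType) (K : set T) (F : set_system T) :
  compact K -> UltraFilter F -> F K -> exists2 p, K p & F --> p.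
Proof.
rewrite compact_ultra => cK FU FK.
by have [p [Kp Fp]] := cK F FU FK; exists p.
Qed.

Instance tails_filter (D : directedSet) : ProperFilter (tails D).
Proof.
apply: filter_from_proper => [|d _]; last by exists d; apply: dir_refl.
apply: filter_from_filter => [|d e _ _].
  by have [d] := dir_inhabited D; exists d.
have [c [dc ec]] := dir_upper d e; exists c => // x cx.
by split; [apply: dir_trans dc cx|apply: dir_trans ec cx].
Qed.

(** The directed set through which filters are traded for nets: the net of its
    points has [F] as its filter of tails ([filter_net_cvg]). *)
Definition filter_net (T : Type) (F : set_system T) {FF : ProperFilter F} :
  directedSet.
Proof.
pose S := {p : set T * T | F p.1 /\ p.1 p.2}.
apply: (@DirectedSet S (fun p q => (sval q).1 `<=` (sval p).1)).
- have [x Tx] := filter_ex (filterT : F setT).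
  by constructor; exists (setT, x); split => //; exact: filterT.
- by move=> d.
- by move=> d e c de ec x cx; apply: de; apply: ec.
- move=> [[A x] /= [FA Ax]] [[B y] /= [FB By]].
  have FAB : F (A `&` B) by apply: filterI.
  have [z ABz] := filter_ex FAB.
  exists (exist _ (A `&` B, z) (conj FAB ABz)) => /=.
  by split=> u [].
Defined.
Arguments filter_net {T} F {FF}.

Definition filter_net_val (T : Type) (F : set_system T) {FF : ProperFilter F}
  (p : filter_net F) : T := (sval p).2.
Arguments filter_net_val {T} F {FF} p.

Lemma filter_net_cvg (T : Type) (F : set_system T) {FF : ProperFilter F} :
  filter_net_val F @ tails (filter_net F) = F.
Proof.
rewrite eqEsubset; split=> A.
  case=> -[[B x] /= [FB Bx]] _ BA; apply: (filterS _ FB) => y By.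
  exact: (BA (exist _ (B, y) (conj FB By))).
move=> FA; have [x Ax] := filter_ex FA.
exists (exist _ (A, x) (conj FA Ax)) => // -[[B y] /= [FB By]] BA; exact: BA.
Qed.

(** Dependent choice when a new term is constrained by all the earlier ones: the
    states are the finite histories, and [good] is the invariant that keeps
    the next step possible. *)
Lemma history_sequence (T : eqType) (good : seq T -> Prop)
    (R : nat -> T -> T -> Prop) :
  good [::] ->
  (forall l, good l ->
    exists2 a, forall b, b \in l -> R (size l) b a & good (a :: l)) ->
  exists u : nat -> T, forall i n, (i < n)%N -> R n (u i) (u n).
Proof.
move=> good0 step; pose X := {l : seq T | good l}.
have next (l : X) : {l' : X | exists2 a, sval l' = a :: sval l
    & forall b, b \in sval l -> R (size (sval l)) b a}.
  apply: cid; case: l => l gl; have [a Ra ga] := step l gl.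
  by exists (exist _ (a :: l) ga), a.
have [h [h0 hS]] := dependent_choice next (exist _ [::] good0).
have [x0 _ _] := step _ good0.
pose u n := head x0 (sval (h n.+1)).
have hSE n : sval (h n.+1) = u n :: sval (h n).
  by rewrite /u; have [a -> _] := hS n.
have size_h n : size (sval (h n)) = n.
  by elim: n => [|n IH]; rewrite ?h0 // hSE /= IH.
have mem_h i n : (i < n)%N -> u i \in sval (h n).
  elim: n => // n IH; rewrite ltnS leq_eqVlt => /orP[/eqP->|/IH uh].
    by rewrite hSE mem_head.
  by rewrite hSE in_cons uh orbT.
exists u => i n /mem_h uin.
have [a aE Ra] := hS n; move: aE; rewrite hSE => -[->].
by rewrite -[X in R X](size_h n); apply: Ra.
Qed.

(** * Complex-valued functions *)

Section Distance.
Context {R : realType}.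
Implicit Types (a b c : cplx R) (e : R).

Definition dist a b : R := Normc.normc (a - b : R[i]).

Lemma normr_dist a b : `|a - b| = (dist a b)%:C.
Proof. by rewrite /dist; case: (a - b). Qed.

Lemma dist_tri b a c : dist a c <= dist a b + dist b c.
Proof.
rewrite /dist; have -> : (a : R[i]) - c = (a - b) + (b - c).
  by rewrite addrA subrK.
exact: le_normcD.
Qed.

Lemma distC a b : dist a b = dist b a.
Proof. by rewrite /dist -normcN opprB. Qed.

Lemma dist_ge0 a b : 0 <= dist a b.
Proof. by rewrite /dist; case: (a - b : R[i]) => x y /=; rewrite sqrtr_ge0. Qed.

Lemma distxx a : dist a a = 0.
Proof. by rewrite /dist subrr Normc.normc0. Qed.

Lemma cvg_dist (T : Type) (F : set_system T) {FF : Filter F}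
    (g : T -> cplx R) a :
  g @ F --> a <-> forall e, 0 < e -> \forall x \near F, dist (g x) a < e.
Proof.
split=> [/cvgrPdist_lt ga e e0|ga].
  have := ga e%:C; rewrite ltcR => /(_ e0); apply: filterS => x.
  by rewrite normr_dist ltcR distC.
apply/cvgrPdist_lt => -[e i]; rewrite ltcE /= => /andP[/eqP -> e0].
by apply: filterS (ga e e0) => x; rewrite normr_dist ltcR distC.
Qed.

Lemma cvg_dist_le (T : Type) (F : set_system T) {FF : ProperFilter F}
    (g : T -> cplx R) a b e :
  g @ F --> a -> (\forall x \near F, dist (g x) b <= e) -> dist a b <= e.
Proof.
move=> /cvg_dist ga gb; apply/ler_addgt0Pr => d d0.
have [x [/= gxa gxb]] := filterI_ex (ga d d0) gb.
have := dist_tri (g x) a b; rewrite (distC a (g x)); lra.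
Qed.

(** A finite-dimensional substitute for compactness of closed discs: the real
    and the imaginary part converge separately. *)
Lemma ultra_bounded_cvg (T : Type) (F : set_system T) (g : T -> cplx R)
    (M : R) :
  UltraFilter F -> (forall x, dist (g x) 0 <= M) ->
  exists a : cplx R, g @ F --> a.
Proof.
move=> FU gM.
have real_cvg (h : T -> R) : (forall x, `|h x| <= M) ->
    exists r : R, h @ F --> r.
  move=> hM; have hF : (h @ F) `[- M, M]%classic.
    apply: (@filterS _ F _ setT) => [x _|]; last exact: filterT.
    by rewrite /= in_itv /= -ler_norml.
  have [r _ hr] := compact_ultra_cvg (@segment_compact R (- M) M) _ hF.
  by exists r.
have bound x : `|complex.Re (g x)| <= M /\ `|complex.Im (g x)| <= M.
  move: (gM x); rewrite /dist subr0; case: (g x) => a b /= abM.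
  by split; apply: le_trans abM; rewrite -sqrtr_sqr ler_wsqrtr //
     ?lerDl ?lerDr sqr_ge0.
have [r /cvgrPdist_lt hr] := real_cvg _ (fun x => (bound x).1).
have [i /cvgrPdist_lt hi] := real_cvg _ (fun x => (bound x).2).
exists (r +i* i : R[i]); apply/cvg_dist => e e0.
have e2 : 0 < e / 2 by lra.
apply: filterS2 (hr _ e2) (hi _ e2) => x.
rewrite /dist; case: (g x) => a b /= ra ib.
have := le_normcD ((a - r) +i* 0 : R[i]) (0 +i* (b - i) : R[i]) => /=.
rewrite expr0n /= !addr0 !add0r !sqrtr_sqr.
rewrite -(distrC r) -(distrC i); lra.
Qed.

End Distance.

(** * The filter of returns *)

Section Returns.
Context {R : realType} {G : topologicalGroupType}.
Implicit Types (f : G -> cplx R) (e : R) (s t x : G) (V : set G).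

(** Both [x] and [x^-1] are tested, because the inverse of a good return is not
    obviously a good one; the symmetry of Bohr sets provides this stronger form
    of return. *)
Definition returns f : set_system G :=
  filter_from [set p : seq G * R | 0 < p.2]
    (fun p => [set x | forall s t, s \in p.1 -> t \in p.1 ->
      dist (f (s * x * t)%g) (f (s * t)%g) < p.2 /\
      dist (f (s * x^-1 * t)%g) (f (s * t)%g) < p.2]).

Lemma returns1 f V : returns f V -> V 1%g.
Proof.
case=> -[N e] /= e0; apply => s t _ _.
by rewrite invg1 mulg1 distxx.
Qed.

#[export] Instance returns_filter f : ProperFilter (returns f).
Proof.
apply: filter_from_proper => [|[N e] /= e0]; last first.
  by exists 1%g => s t _ _; rewrite invg1 mulg1 distxx.
apply: filter_from_filter => [|[N d] [M e] /= d0 e0].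
  by exists ([::], 1); rewrite /= ltr01.
exists (N ++ M, Order.min d e) => /=; first by rewrite lt_min d0 e0.
move=> x Vx; split=> s t sN tN; have := Vx s t;
  rewrite !mem_cat sN tN ?orbT !lt_min => /(_ isT isT);
  by case=> /andP[? ?] /andP[? ?].
Qed.

Lemma returns_near f s t e : 0 < e ->
  \forall x \near returns f, dist (f (s * x * t)%g) (f (s * t)%g) < e /\
    dist (f (s * x^-1 * t)%g) (f (s * t)%g) < e.
Proof.
by move=> e0; exists ([:: s; t], e) => //= x; apply; rewrite !inE eqxx ?orbT.
Qed.

(** Membership in [returns f] is a finite conjunction of conditions, so a map
    into [G] tends to [returns f] as soon as each condition holds eventually. *)
Lemma returns_coarsest f (T : Type) (F : set_system T) (u : T -> G) :
  Filter F ->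
  (forall s t e, 0 < e ->
    \forall x \near F, dist (f (s * u x * t)%g) (f (s * t)%g) < e) ->
  (forall s t e, 0 < e ->
    \forall x \near F, dist (f (s * (u x)^-1 * t)%g) (f (s * t)%g) < e) ->
  forall V, returns f V -> \forall x \near F, V (u x).
Proof.
move=> FF Fu FuV V [[N e] /= e0 NV].
have : \forall x \near F, forall s, s \in N -> forall t, t \in N ->
    dist (f (s * u x * t)%g) (f (s * t)%g) < e /\
    dist (f (s * (u x)^-1 * t)%g) (f (s * t)%g) < e.
  apply: near_seq => s _; apply: near_seq => t _.
  exact: filterS2 (Fu s t e e0) (FuV s t e e0).
by apply: (@filterS _ F) => x Nx; apply: NV => s t sN tN; exact: Nx.
Qed.

Lemma returnsV f V : returns f V -> \forall x \near returns f, V x^-1%g.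
Proof.
apply: returns_coarsest => s t e e0;
  apply: filterS (returns_near f s t e0) => x.
  by case.
by rewrite invgK; case.
Qed.

Lemma returns_conj f k V :
  returns f V -> \forall x \near returns f, V (k^-1 * x * k)%g.
Proof.
apply: returns_coarsest => s t e e0;
  apply: filterS (returns_near f (s * k^-1)%g (k * t)%g e0) => x;
  by rewrite ?invgM ?invgK !mulgA mulgVK; case.
Qed.

Lemma returnsM f V : returns f V ->
  \forall x \near returns f, \forall y \near returns f, V (x * y)%g.
Proof.
move=> fV; have e2 e : 0 < e -> 0 < e / 2 by move=> ?; lra.
suff : \forall p \near iterated (returns f) (returns f), V (p.1 * p.2)%g by [].
apply: returns_coarsest fV => s t e /e2 e0;
  apply: (filterS _ (returns_near f s t e0)) => x [fx fxV].
- apply: filterS (returns_near f (s * x)%g t e0) => y [fy _] /=.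
  rewrite mulgA; have := dist_tri (f (s * x * t)%g) (f (s * x * y * t)%g).
  by move=> /(_ (f (s * t)%g)); lra.
- apply: filterS (returns_near f s (x^-1 * t)%g e0) => y [_ fy] /=.
  move: fy; rewrite invgM !mulgA => fy.
  have := dist_tri (f (s * x^-1 * t)%g) (f (s * y^-1 * x^-1 * t)%g).
  by move=> /(_ (f (s * t)%g)); lra.
Qed.

Lemma returns_inv f : returns (f \o monoid.inv) = returns f.
Proof.
have sub h : returns h `<=` returns (h \o monoid.inv).
  move=> V.
  apply: (@returns_coarsest h G (returns (h \o monoid.inv)) id _) => s t e e0;
    apply: filterS (returns_near (h \o monoid.inv) t^-1%g s^-1%g e0) => x;
    by rewrite /= !invgM !invgK !mulgA; case.
rewrite eqEsubset; split; last exact: sub.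
apply: subset_trans (sub _) _; rewrite (_ : _ \o _ = f) //.
by apply: funext => x /=; rewrite invgK.
Qed.

(** For bounded continuous [f] this is [LUC f], with neighbourhoods instead
    of nets. *)
Definition left_uniform f := forall x e, 0 < e ->
  \forall y \near x, forall z, dist (f (y * z)%g) (f (x * z)%g) <= e.

Lemma left_uniform_cvg f (T : Type) (F : set_system T) {FF : Filter F}
    (u : T -> G) x e :
  left_uniform f -> u @ F --> x -> 0 < e ->
  \forall y \near F, forall z, dist (f (u y * z)%g) (f (x * z)%g) <= e.
Proof. by move=> fu ux e0; apply: ux (fu x e e0). Qed.

(** Together with stability under inversion and conjugation, this makes
    [returns f] the filter of neighbourhoods of [1] for a group topology; the
    quotient [y^-1 x] is covered by exchanging [x] and [y]. *)
Definition returns_divide f := forall s t e, 0 < e ->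
  exists2 W, returns f W &
    forall x y, W x -> W y -> dist (f (s * x^-1 * y * t)%g) (f (s * t)%g) < e.

Definition returns_precompact f := forall V, returns f V ->
  exists l : seq G, forall x, exists2 k, k \in l & V (k^-1 * x)%g.

End Returns.

(** * From Bohr sets to precompact returns *)

Section TopologicalGroup.
Context {G : topologicalGroupType}.

Lemma cvgMg (T : Type) (F : set_system T) {FF : Filter F} (u v : T -> G) x y :
  u @ F --> x -> v @ F --> y ->
  (fun i => u i * v i)%g @ F --> (x * y)%g.
Proof.
move=> ux vy.
exact: (continuous2_cvg (h := fun a b : G => (a * b)%g) _
  (mulg_continuous (x, y)) ux vy).
Qed.

Lemma cvgVg (T : Type) (F : set_system T) {FF : Filter F} (u : T -> G) x :
  u @ F --> x -> (fun i => (u i)^-1)%g @ F --> (x^-1)%g.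
Proof. by move=> ux; apply: continuous_cvg ux; apply: invg_continuous. Qed.

Lemma cvg_cstg (T : Type) (F : set_system T) {FF : Filter F} (x : G) :
  (fun _ : T => x) @ F --> x.
Proof. exact: cvg_cst. Qed.

End TopologicalGroup.

Section BohrReturns.
Context {R : realType} {G : topologicalGroupType}.
Implicit Types (f : G -> cplx R) (e : R) (s t x : G) (V B K : set G).

Lemma bohr_sets f (N : seq G) e : bohr_aa f -> 0 < e ->
  exists B, exists2 K, compact K &
    [/\ forall x, exists2 k, K k & B (k * x)%g,
        forall b, B b -> B b^-1%g,
        forall b s t, B b -> s \in N -> t \in N ->
          dist (f (s * b * t)%g) (f (s * t)%g) < e &
        forall b c s t, B b -> B c -> s \in N -> t \in N ->
          dist (f (s * b^-1 * c * t)%g) (f (s * t)%g) < 2 * e].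
Proof.
move=> [fB _] e0; have [B [[K cK KB] BV Bc Bd]] := fB _ e (finite_seq N) e0.
exists B, K => //; split.
- move=> x; have : [set: G] x by [].
  rewrite KB => -[k Kk [b Bb <-]].
  by exists k => //; rewrite mulVKg.
- by move=> b Bb; rewrite BV; exists b.
- by move=> b s t Bb sN tN; rewrite -ltcR -normr_dist; apply: Bc.
- by move=> b c s t Bb Bc' sN tN; rewrite -ltcR -normr_dist; apply: Bd.
Qed.

(** By [ultra_finite_cover] it suffices to treat one ultrafilter at a time. It
    makes the compact parts [k] of [x = k^-1 b] converge to some [k0], and by
    uniform continuity [k0 x] is then almost as good a return as [b = k x]. *)
Lemma bohr_returns_precompact f :
  bohr_aa f -> left_uniform f -> left_uniform (f \o monoid.inv) ->
  returns_precompact f.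
Proof.
move=> fB fl fr V [[N e] /= e0 NV].
have e2 : 0 < e / 2 by lra.
have e4 : 0 < e / 4 by lra.
have [B [K cK [KB BV Bc _]]] := bohr_sets N fB e2.
have /choice[k k_spec] : forall x, exists k, K k /\ B (k * x)%g.
  by move=> x; have [k Kk Bk] := KB x; exists k.
apply: (ultra_finite_cover (S := fun k => [set x | V (k^-1 * x)%g])) => F FU.
have FK : (k @ F) K.
  by apply: (@filterS _ F _ setT) => [x _|]; [case: (k_spec x)|exact: filterT].
have [k0 _ kk0] := compact_ultra_cvg cK _ FK.
exists k0^-1%g => /=.
have near_cst s : (fun x => s * k0 * (k x)^-1)%g @ F --> s.
  rewrite -[X in _ --> X](mulgK k0 s).
  by apply: cvgMg; [exact: cvg_cstg|exact: cvgVg].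
have Fl : \forall x \near F, forall s, s \in N -> forall z,
    dist (f (s * k0 * (k x)^-1 * z)%g) (f (s * z)%g) <= e / 4.
  apply: near_seq => s _; exact: left_uniform_cvg fl (near_cst s) e4.
have Fr : \forall x \near F, forall t, t \in N -> forall z,
    dist (f (z * k x * k0^-1 * t)%g) (f (z * t)%g) <= e / 4.
  apply: near_seq => t _.
  apply: filterS (left_uniform_cvg fr (near_cst t^-1%g) e4) => x Hx z.
  have := Hx z^-1%g.
  by rewrite /= !invgM !invgK !mulgA.
apply: filterS2 Fl Fr => x Fl Fr; apply: NV => s t sN tN.
have [_ Bx] := k_spec x; rewrite invgK; split.
- have := Fl s sN (k x * x * t)%g; have := Bc _ s t Bx sN tN.
  rewrite !mulgA mulgVK.
  have := dist_tri (f (s * k x * x * t)%g) (f (s * k0 * x * t)%g) (f (s * t)%g).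
  lra.
- have := Fr t tN (s * x^-1 * (k x)^-1)%g; have := Bc _ s t (BV _ Bx) sN tN.
  rewrite invgM !mulgA mulgVK invgM !mulgA.
  have := dist_tri (f (s * x^-1 * (k x)^-1 * t)%g)
    (f (s * x^-1 * k0^-1 * t)%g) (f (s * t)%g).
  lra.
Qed.

End BohrReturns.

Section Colouring.
Context {R : realType} {G : topologicalGroupType}.
Implicit Types (f : G -> cplx R) (e d : R) (s t x y p k : G).

(** Finitely many colours [k] cover [G], and the quotient of two elements of
    colour [k] is a good return after conjugation by [k]. The colour [k] cannot
    be prescribed, but it can be made stable: choose [p] such that the set of
    colours met by [p a] for arbitrarily good returns [a] is minimal.
    That set is then the same at [p a] for every sufficiently good return [a],
    so two such returns [a], [b] can be corrected by much better ones [a'], [b']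
    into [p a a'] and [p b b'] of one same colour [k]. Hence [a^-1 b] is good
    after conjugation by [k], and the filter of returns is stable under
    conjugation. *)
Lemma colouring_divide f s t e d (l : seq G) (X : G -> set G) :
  0 < d -> (forall x, exists2 k, k \in l & X k x) ->
  (forall k x y, X k x -> X k y ->
    dist (f (s * k * x^-1 * y * k^-1 * t)%g) (f (s * t)%g) < e) ->
  exists2 W, returns f W & forall a b, W a -> W b ->
    dist (f (s * a^-1 * b * t)%g) (f (s * t)%g) < e + 2 * d.
Proof.
move=> d0 Xcover Xdist; pose c (i : 'I_(size l)) := nth 1%g l i.
pose often p i := forall V, returns f V -> exists2 a, V a & X (c i) (p * a)%g.
pose C p := [set i | `[< often p i >]]%SET.
(* [C p] is the set of colours met by [p a] for arbitrarily good returns [a]. *)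
have [p p_min] : exists p, forall q, (#|C p| <= #|C q|)%N.
  have ex_card : exists n, `[< exists q, #|C q| = n >].
    by exists #|C 1%g|; apply/asboolP; exists 1%g.
  case: (ex_minnP ex_card) => n /asboolP[q <-] q_min.
  by exists q => r; apply: q_min; apply/asboolP; exists r.
have rare i : i \notin C p -> \forall a \near returns f, ~ X (c i) (p * a)%g.
  rewrite inE => /asboolPn /existsNP[V /not_implyP[fV nV]].
  by apply: filterS fV => a Va Xa; apply: nV; exists a.
have stable : \forall a \near returns f, C (p * a)%g = C p.
  have : \forall a \near returns f, forall i, i \notin C p ->
      ~ X (c i) (p * a)%g.
    have : \forall a \near returns f, forall i, i \in enum 'I_(size l) ->
        i \notin C p -> ~ X (c i) (p * a)%g.
      apply: near_seq => i _; case: (boolP (i \in C p)) => [_|/rare].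
        exact: nearW.
      exact: filterS.
    by apply: filterS => a Ha i; apply: Ha; rewrite mem_enum.
  move=> /returnsM; apply: filterS => a Ha.
  apply/eqP; rewrite eqEcard p_min andbT; apply/fintype.subsetP => i.
  rewrite inE => /asboolP oft; apply: contrapT => /negP iC.
  by have [b /(_ i iC) nX] := oft _ Ha; rewrite -mulgA.
have [i ip] : exists i, i \in C p.
  have [k kl Xk] := Xcover p.
  have kl' : (index k l < size l)%N by rewrite index_mem.
  exists (Ordinal kl'); rewrite inE; apply/asboolP => V fV; exists 1%g.
    exact: returns1 fV.
  by rewrite mulg1 /c /= nth_index.
exists [set a | C (p * ((c i)^-1 * a * c i))%g = C p].
  exact: returns_conj stable.
move=> a b /= pa pb; set k := c i in pa pb.
pose a1 := (k^-1 * a * k)%g; pose b1 := (k^-1 * b * k)%g.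
have : i \in C (p * a1)%g by rewrite /a1 pa.
rewrite inE => /asboolP oft_a.
have [a' [_ a'V] Xa] := oft_a _
  (returns_near f (s * k)%g (a1^-1 * b1 * k^-1 * t)%g d0).
have : i \in C (p * b1)%g by rewrite /b1 pb.
rewrite inE => /asboolP oft_b.
have [b' [b'V _] Xb] := oft_b _
  (returns_near f (s * k * a'^-1 * a1^-1 * b1)%g (k^-1 * t)%g d0).
have := Xdist _ _ _ Xa Xb; rewrite -/k.
have -> : (s * k * (p * a1 * a')^-1 * (p * b1 * b') * k^-1 * t =
    s * k * a'^-1 * a1^-1 * b1 * b' * (k^-1 * t))%g.
  by rewrite !invgM !mulgA mulgVK.
move: a'V b'V.
have -> : (s * k * a'^-1 * (a1^-1 * b1 * k^-1 * t) =
  s * k * a'^-1 * a1^-1 * b1 * (k^-1 * t))%g by rewrite !mulgA.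
have -> : (s * k * (a1^-1 * b1 * k^-1 * t) = s * a^-1 * b * t)%g.
  by rewrite /a1 /b1 !invgM !invgK !mulgA !(mulgK, mulgVK).
set u := f _; set v := f _; set w := f _; set z := f _.
have := dist_tri u v z; have := dist_tri w u z.
by rewrite (distC v u) (distC u w); lra.
Qed.

(** The colour of [x = b h] is a point of the compact set close to [h]; the
    conjugation in [colouring_divide] brings the small errors [k h^-1] next to
    [s] and [t], where uniform continuity absorbs them. *)
Lemma bohr_returns_divide f :
  bohr_aa f -> left_uniform f -> left_uniform (f \o monoid.inv) ->
  returns_divide f.
Proof.
move=> fB fl fr s t e e0.
(* Two steps of uniform continuity and the 2 e' of the Bohr set make 4 e' for
   the colouring, and the colour argument costs another 2 e'. *)
have e6 : 0 < e / 6 by lra.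
have [B [K cK [KB BV _ Bd]]] := bohr_sets [:: s; t] fB e6.
pose X k x := exists b h, [/\ B b, x = (b * h)%g,
  forall z, dist (f (s * k * h^-1 * z)%g) (f (s * z)%g) <= e / 6 &
  forall z, dist (f (z * h * k^-1 * t)%g) (f (z * t)%g) <= e / 6].
have /choice[h h_spec] : forall x, exists h, K h /\
    exists2 b, B b & x = (b * h)%g.
  move=> x; have [k Kk Bkx] := KB x^-1%g; exists k; split=> //.
  by exists (k * x^-1)^-1%g; [exact: BV|rewrite invgM invgK mulgVK].
have [l Xl] : exists l : seq G, forall x, exists2 k, k \in l & X k x.
  apply: ultra_finite_cover => F FU.
  have FK : (h @ F) K.
    apply: (@filterS _ F _ setT) => [x _|]; last exact: filterT.
    by case: (h_spec x).
  have [k0 _ hk0] := compact_ultra_cvg cK _ FK; exists k0.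
  have near_cst y : (fun x => y * k0 * (h x)^-1)%g @ F --> y.
    rewrite -[X in _ --> X](mulgK k0 y).
    by apply: cvgMg; [exact: cvg_cstg|exact: cvgVg].
  apply: filterS2 (left_uniform_cvg fl (near_cst s) e6)
    (left_uniform_cvg fr (near_cst t^-1%g) e6) => x Fl Fr.
  have [_ [b Bb xE]] := h_spec x; exists b, (h x); split=> // z.
  by have := Fr z^-1%g; rewrite /= !invgM !invgK !mulgA.
have [k x y [b [g [Bb -> Xl1 _]]] [c [h' [Bc -> _ Xr]]]|W fW Wd] :=
    @colouring_divide f s t (4 * (e / 6)) (e / 6) l X e6 Xl.
  have := Xl1 (b^-1 * c * h' * k^-1 * t)%g; have := Xr (s * b^-1 * c)%g.
  have := Bd b c s t Bb Bc; rewrite !inE !eqxx ?orbT => /(_ isT isT).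
  rewrite invgM !mulgA.
  set u := f _; set v := f _; set w := f _; set z := f _.
  have := dist_tri w z v; have := dist_tri u w v; lra.
exists W => // x y Wx Wy; have := Wd x y Wx Wy; lra.
Qed.

End Colouring.

(** * Bochner functions through ultrafilters *)

Lemma cvg_reindex (R : realType) (T U : Type) (h : T -> U) (g : U -> cplx R)
    (H : set_system T) (F : set_system U) (a : cplx R) :
  h @ H = F -> (fun i => g (h i)) @ H --> a <-> g @ F --> a.
Proof. by move=> <-. Qed.

Section Bochner.
Context {R : realType} {G : topologicalGroupType}.
Implicit Types (f phi : G -> cplx R) (e : R) (s t x y : G) (V : set G).

(** Along an ultrafilter no subnet has to be extracted. *)
Definition ultra_aaL f := forall F : set_system G, UltraFilter F ->
  exists phi, [/\ continuous phi,
    forall y, (fun x => f (y * x)%g) @ F --> phi y &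
    forall y, (fun x => phi (y * x^-1)%g) @ F --> f y].

Lemma bochner_aaLP f : bochner_aaL f <-> ultra_aaL f.
Proof.
split=> [fL F FU|fL D t].
- have [E [h [phi [hsub cphi fphi phif]]]] :=
    fL (filter_net F) (filter_net_val F).
  have hF : (filter_net_val F \o h) @ tails E = F.
    apply: (@max_filter _ F FU _ _) => A FA; have [x Ax] := filter_ex FA.
    have [e0 he0] := hsub (exist _ (A, x) (conj FA Ax)).
    exists e0 => // e /he0 /=; rewrite /filter_net_val /=.
    by case: (h e) => -[B y] /= [_ By]; exact.
  exists phi; split; [exact: cphi|move=> y|move=> y].
    exact: (cvg_reindex (fun x => f (y * x)%g) _ hF).1 (fphi y).
  exact: (cvg_reindex (fun x => phi (y * x^-1)%g) _ hF).1 (phif y).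
- have [U [UU tailsU]] := ultraFilterLemma (tails_filter D).
  have [phi [cphi fphi phif]] := fL _ (ultra_fmap t UU).
  exists (filter_net U), (filter_net_val U), phi; split.
  + move=> d; have Ud : U [set e | dir_le d e] by apply: tailsU; exists d.
    exists (exist _ ([set e | dir_le d e], d) (conj Ud (dir_refl d))).
    by move=> [[B e] /= [UB Be]] BA; exact: BA.
  + exact: cphi.
  + move=> x.
    exact: (cvg_reindex (fun d => f (x * t d)%g) (phi x)
      (@filter_net_cvg _ U _)).2 (fphi x).
  + move=> x.
    exact: (cvg_reindex (fun d => phi (x * (t d)^-1)%g) (f x)
      (@filter_net_cvg _ U _)).2 (phif x).
Qed.

(** Inversion exchanges left and right translations. *)
Lemma bochner_aaR_inv f : bochner_aaR f <-> bochner_aaL (f \o monoid.inv).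
Proof.
have inv_cvg (phi : G -> cplx R) : continuous phi ->
    continuous (phi \o monoid.inv).
  move=> cphi x; apply: continuous_comp; [exact: invg_continuous|exact: cphi].
split=> fa D t; have [E [h [phi [hsub cphi fphi phif]]]] :=
    fa D (fun d => (t d)^-1%g); exists E, h, (phi \o monoid.inv);
    (split; [exact: hsub|exact: inv_cvg|move=> x|move=> x]).
- have := fphi x^-1%g; rewrite /fmulg /mulgf /=.
  by under eq_fun do rewrite -invgM.
- have := phif x^-1%g; rewrite /fmulg /mulgf /=.
  by under eq_fun do rewrite -invgM.
- have := fphi x^-1%g; rewrite /fmulg /mulgf /=.
  by under eq_fun do rewrite -invgM invgK.
- have := phif x^-1%g; rewrite /fmulg /mulgf /= invgK.
  by under [in X in X -> _]eq_fun do
    rewrite invgK -(invgK (x^-1 * _)%g) invgM invgK.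
Qed.

(** This is the defining property of [f] for the translated ultrafilter of the
    [x t], read at the point [s t]. *)
Lemma ultra_aaL_iterated f (F : set_system G) s t e :
  ultra_aaL f -> UltraFilter F -> 0 < e ->
  \forall x \near F, \forall y \near F,
    dist (f (s * x^-1 * y * t)%g) (f (s * t)%g) < e.
Proof.
move=> fa FU e0; have e2 : 0 < e / 2 by lra.
have [phi [_ fphi phif]] := fa _ (ultra_fmap (fun x => x * t)%g FU).
have /cvg_dist/(_ _ e2) := phif (s * t)%g; apply: (@filterS _ F) => x /= phix.
have /cvg_dist/(_ _ e2) := fphi (s * x^-1)%g; apply: (@filterS _ F) => y /= fy.
move: phix fy; rewrite invgM !mulgA mulgK.
have := dist_tri (phi (s * x^-1)%g) (f (s * x^-1 * y * t)%g) (f (s * t)%g).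
lra.
Qed.

Lemma bochner_returns f (F : set_system G) V :
  ultra_aaL f -> ultra_aaL (f \o monoid.inv) -> UltraFilter F ->
  returns f V -> \forall x \near F, \forall y \near F, V (x^-1 * y)%g.
Proof.
move=> fl fr FU fV.
suff : \forall p \near iterated F F, V (p.1^-1 * p.2)%g by [].
apply: returns_coarsest fV => s t e e0.
  have := ultra_aaL_iterated s t fl FU e0; apply: (@filterS _ F) => x.
  by apply: (@filterS _ F) => y /=; rewrite !mulgA.
have := ultra_aaL_iterated t^-1%g s^-1%g fr FU e0; apply: (@filterS _ F) => x.
apply: (@filterS _ F) => y /=; rewrite !invgM !invgK !mulgA.
by [].
Qed.

Lemma bochner_returns_precompact f :
  ultra_aaL f -> ultra_aaL (f \o monoid.inv) -> returns_precompact f.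
Proof.
move=> fl fr V fV.
apply: (ultra_finite_cover (S := fun k => [set x | V (k^-1 * x)%g])) => F FU.
by have /filter_ex[x Fx] := bochner_returns fl fr FU fV; exists x.
Qed.

(** If quotients [x^-1 y] of arbitrarily good returns stay bad, then the
    products [a_n = y_0 ... y_(n-1) x_n] of sufficiently good ones have
    all their quotients [a_i^-1 a_n] bad, against the iterated limit. *)
Lemma bochner_returns_divide f :
  ultra_aaL f -> ultra_aaL (f \o monoid.inv) -> returns_divide f.
Proof.
move=> fl fr s t e e0; apply: contrapT => ndiv.
pose bad x := e / 2 < dist (f (s * x * t)%g) (f (s * t)%g).
have bad_pair W : returns f W -> exists x y, [/\ W x, W y & bad (x^-1 * y)%g].
  move=> fW; apply: contrapT => nW; apply: ndiv; exists W => // x y Wx Wy.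
  rewrite ltNge; apply/negP => exy; apply: nW; exists x, y; split=> //.
  by rewrite /bad !mulgA; lra.
have bad_near x : bad x -> \forall y \near returns f, bad (x * y)%g.
  move=> xbad; pose d := dist (f (s * x * t)%g) (f (s * t)%g) - e / 2.
  have d0 : 0 < d by rewrite /d subr_gt0.
  apply: filterS (returns_near f (s * x)%g t d0) => y [fy _].
  move: xbad fy; rewrite /bad /d mulgA => xbad fy.
  have := dist_tri (f (s * x * y * t)%g) (f (s * x * t)%g) (f (s * t)%g).
  by rewrite (distC (f (s * x * t)%g) (f (s * x * y * t)%g)); lra.
(* A term is a pair: a_n and the product of the y_i up to i = n. *)
pose last_prod (l : seq (G * G)) := (head (1%g, 1%g) l).2.
have [a a_bad] : exists a : nat -> G * G, forall i n, (i < n)%N ->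
    bad ((a i).1^-1 * (a n).1)%g.
  apply: (@history_sequence (G * G)%type
    (fun l => forall b, b \in l -> bad (b.1^-1 * last_prod l)%g)
    (fun _ b c => bad (b.1^-1 * c.1)%g)) => // l lbad.
  have W_near : \forall z \near returns f, forall b, b \in l ->
      bad (b.1^-1 * last_prod l * z)%g.
    by apply: near_seq => b /lbad/bad_near.
  have [x [y [Wx Wy xy]]] := bad_pair _ W_near.
  exists (last_prod l * x, last_prod l * y)%g => [b /Wx|b].
    by rewrite /= mulgA.
  rewrite in_cons => /orP[/eqP->|/Wy] /=; last by rewrite mulgA.
  by rewrite /last_prod /= invgM !mulgA mulgVK.
have [U [UU ooU]] := ultraFilterLemma eventually_filter.
have e2 : 0 < e / 2 by lra.
have /filter_ex[i Ui] : \forall i \near U, \forall n \near U,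
    dist (f (s * (a i).1^-1 * (a n).1 * t)%g) (f (s * t)%g) < e / 2.
  by have := ultra_aaL_iterated s t fl (ultra_fmap (fst \o a) UU) e2.
have Ugt : U [set n | (i < n)%N] by apply: ooU; exists i.+1.
have [n [/= an /a_bad]] := filterI_ex Ui Ugt.
by rewrite /bad mulgA; lra.
Qed.

(** * From precompact returns back to Bochner and Bohr *)

(** Boundedness provides the limit function [phi], uniformity its continuity,
    and a translate [k W] that belongs to the ultrafilter its return to [f]. *)
Lemma precompact_ultra_aaL f (M : R) :
  (forall x, dist (f x) 0 <= M) -> left_uniform f ->
  returns_divide f -> returns_precompact f -> ultra_aaL f.
Proof.
move=> fM fu fd fp F FU.
have /choice[phi fphi] : forall y, exists a : cplx R,
    (fun x => f (y * x)%g) @ F --> a.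
  by move=> y; apply: ultra_bounded_cvg => x; exact: fM.
exists phi; split; [|exact: fphi|].
- move=> y; apply/cvg_dist => e e0; have e2 : 0 < e / 2 by lra.
  apply: filterS (fu y _ e2) => z fz.
  apply: le_lt_trans (_ : e / 2 < e); last lra.
  apply/ler_addgt0Pr => d d0; have d2 : 0 < d / 2 by lra.
  have /cvg_dist/(_ _ d2) Fz := fphi z; have /cvg_dist/(_ _ d2) Fy := fphi y.
  have [x [/= fzx fyx]] := filterI_ex Fz Fy.
  have := fz x; have := dist_tri (f (z * x)%g) (phi z) (phi y).
  have := dist_tri (f (y * x)%g) (f (z * x)%g) (phi y).
  by rewrite (distC (phi z) (f (z * x)%g)); lra.
- move=> y; apply/cvg_dist => e e0; have e2 : 0 < e / 2 by lra.
  have [W fW Wd] := fd y 1%g _ e2.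
  have [l lW] := fp W fW; have [k _ Fk] := ultra_finite_union FU lW.
  apply: filterS (Fk) => x /= Wx; apply: le_lt_trans (_ : e / 2 < e); last lra.
  apply: (cvg_dist_le (fphi (y * x^-1)%g)); apply: filterS (Fk) => z /= Wz.
  have := Wd _ _ Wx Wz; rewrite invgM invgK !mulgA mulgK !mulg1; exact: ltW.
Qed.

(** A member [V] of [returns f] with small quotients gives the Bohr set
    [V :&: V^-1]. *)
Lemma returns_bohr f : returns_divide f -> returns_precompact f -> UC f ->
  bohr_aa f.
Proof.
move=> fd fp fU; split=> // N e /finite_seqP[l ->] e0.
have e2 : 0 < 2 * e by lra.
have /choice[W Wd] : forall st : G * G, exists W, returns f W /\
    forall x y, W x -> W y ->
      dist (f (st.1 * x^-1 * y * st.2)%g) (f (st.1 * st.2)%g) < 2 * e.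
  by move=> [s t]; have [W fW Wd] := fd s t _ e2; exists W.
pose V x := forall s, s \in l -> forall t, t \in l ->
  W (s, t) x /\ dist (f (s * x * t)%g) (f (s * t)%g) < e.
have fV : \forall x \near returns f, V x.
  apply: near_seq => s _; apply: near_seq => t _.
  by apply: filterS2 (Wd (s, t)).1 (returns_near f s t e0) => x ? [].
pose B : set G := [set x | V x /\ V x^-1%g].
have fB : returns f B by apply: filterI fV (returnsV fV).
have [k Bk] := fp B fB.
exists B; split.
- exists [set` [seq x^-1%g | x <- k]]; first exact/finite_compact/finite_seq.
  rewrite eqEsubset; split=> // x _; have [y yk By] := Bk x.
  exists y^-1%g; first by rewrite /= map_f.
  by exists (y^-1 * x)%g => //; rewrite invgK mulVKg.
- rewrite eqEsubset; split=> x.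
    by move=> [Vx VVx]; exists x^-1%g; rewrite ?invgK //; split; rewrite ?invgK.
  by move=> [y [Vy VVy] <-]; split; rewrite ?invgK.
- move=> b [Vb _] s t sl tl; rewrite normr_dist ltcR.
  exact: (Vb s sl t tl).2.
- move=> b c [Vb _] [Vc _] s t sl tl; rewrite normr_dist ltcR.
  by have := (Wd (s, t)).2 b c (Vb s sl t tl).1 (Vc s sl t tl).1.
Qed.

End Bochner.

(** * Uniform continuity *)

Section BoundedContinuous.
Context {R : realType} {G : topologicalGroupType}.
Implicit Types (f phi : G -> cplx R) (e : R) (s t x y : G).

Lemma ultra_aaL_bounded f :
  ultra_aaL f -> exists M, forall x, dist (f x) 0 <= M.
Proof.
move=> fa; have [l lM] : exists l : seq R, forall x,
    exists2 r, r \in l & dist (f x) 0 <= r.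
  apply: (ultra_finite_cover (S := fun r => [set x | dist (f x) 0 <= r])).
  move=> F FU; have [phi [_ fphi _]] := fa F FU.
  exists (1 + dist (phi 1%g) 0).
  have /cvg_dist/(_ _ ltr01) := fphi 1%g; apply: (@filterS _ F) => x /=.
  rewrite mul1g; have := dist_tri (phi 1%g) (f x) 0; lra.
exists (\big[Order.max/0]_(r <- l) r) => x; have [r rl xr] := lM x.
by apply: (le_trans xr); apply: (le_bigmax_seq _ _ xpredT id).
Qed.

Lemma ultra_aaL_continuous f : ultra_aaL f -> continuous f.
Proof.
move=> fa; have [phi [cphi fphi _]] := fa _ (principal_filter_ultra 1%g).
rewrite (_ : f = phi) //; apply: funext => y; apply/eqP.
have d0 : dist (f y) (phi y) <= 0.
  apply/ler_addgt0Pr => e e0; rewrite add0r; apply: ltW.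
  have /cvg_dist/(_ _ e0)/principal_filterP := fphi y.
  by rewrite mulg1.
rewrite -subr_eq0; apply/eqP/Normc.eq0_normc/eqP; rewrite eq_le d0.
exact: dist_ge0.
Qed.

(** Ultrafilters of translates of [f] converge pointwise, so the translates form
    a totally bounded set for pointwise convergence. *)
Lemma ultra_aaL_totally_bounded f (l : seq G) e : ultra_aaL f -> 0 < e ->
  exists k : seq G, forall x, exists2 y, y \in k &
    forall q, q \in l -> dist (f (q * x)%g) (f (q * y)%g) <= e.
Proof.
move=> fa e0; have e2 : 0 < e / 2 by lra.
apply: (ultra_finite_cover (S := fun y => [set x | forall q, q \in l ->
  dist (f (q * x)%g) (f (q * y)%g) <= e])) => F FU.
have [phi [_ fphi _]] := fa F FU.
have Fl : \forall x \near F, forall q, q \in l ->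
    dist (f (q * x)%g) (phi q) < e / 2.
  by apply: near_seq => q _; have /cvg_dist/(_ _ e2) := fphi q.
have [y ly] := filter_ex Fl; exists y.
apply: filterS Fl => x lx q ql; have := lx q ql; have := ly q ql.
have := dist_tri (phi q) (f (q * x)%g) (f (q * y)%g).
rewrite (distC (phi q)); lra.
Qed.

End BoundedContinuous.

Section JointContinuity.
Context {R : realType} {G : topologicalGroupType}.
Implicit Types (f phi : G -> cplx R) (e : R) (s t x y : G).

Lemma dist_move (a b c d : cplx R) :
  dist a b <= dist a c + dist c d + dist d b.
Proof. have := dist_tri c a b; have := dist_tri d c b; lra. Qed.

(** Grothendieck's double limit criterion, for [f (q x)] and [f (q x')]: since
    limits of translates of [f] are continuous, the two iterated limits of
    [f (q_m x_n) - f (q_m x'_n)] agree. *)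
Lemma double_limit f (C : set G) (q x x' : nat -> G) e :
  ultra_aaL f -> compact C -> 0 < e ->
  (forall i n, (i < n)%N -> C (q n) /\
    dist (f (q i * x n)%g) (f (q i * x' n)%g) <= n.+1%:R^-1) ->
  ~ (forall i n, (i < n)%N -> e < dist (f (q n * x i)%g) (f (q n * x' i)%g)).
Proof.
move=> fa cC e0 qC qe.
have [U [UU ooU]] := ultraFilterLemma eventually_filter.
have Ugt i : \forall n \near U, (i < n)%N by apply: ooU; exists i.+1.
have UC : (q @ U) C by apply: (@filterS _ U) (Ugt 0%N) => n /qC[].
have [q0 _ qq0] := compact_ultra_cvg cC _ UC.
have [phi [cphi fphi _]] := fa _ (ultra_fmap x UU).
have [phi' [cphi' fphi' _]] := fa _ (ultra_fmap x' UU).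
have fc := ultra_aaL_continuous fa.
(* The chain of comparisons below has nine links. *)
pose d := e / 10; have d0 : 0 < d by rewrite /d; lra.
have toq0 (g : G -> cplx R) y : continuous g ->
    \forall m \near U, dist (g (q m * y)%g) (g (q0 * y)%g) < d.
  move=> cg; have qy : (fun m => q m * y)%g @ U --> (q0 * y)%g.
    by apply: cvgMg => //; exact: cvg_cstg.
  have gq : (fun m => g (q m * y)%g) @ U --> g (q0 * y)%g.
    exact: (continuous_cvg _ (cg _) qy).
  by have /cvg_dist/(_ _ d0) := gq.
have [m [m1 m2]] := filterI_ex (toq0 phi 1%g cphi) (toq0 phi' 1%g cphi').
have tophi y : \forall n \near U, dist (f (y * x n)%g) (phi y) < d /\
    dist (f (y * x' n)%g) (phi' y) < d.
  have n1 : \forall n \near U, dist (f (y * x n)%g) (phi y) < d.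
    by have /cvg_dist/(_ _ d0) := fphi y.
  have n2 : \forall n \near U, dist (f (y * x' n)%g) (phi' y) < d.
    by have /cvg_dist/(_ _ d0) := fphi' y.
  by apply: filterS2 n1 n2.
have Uinv : \forall n \near U, (m < n)%N /\ n.+1%:R^-1 < d.
  have n2 : U [set n | n.+1%:R^-1 < d].
    by apply: ooU; exact: (near_infty_natSinv_lt (PosNum d0)).
  by apply: filterS2 (Ugt m) n2.
have [n [[[n1 n2] [n3 n4]] [mn nd]]] :=
  filterI_ex (filterI (tophi (q m)) (tophi q0)) Uinv.
have [p [[p1 p2] /qe pn]] :=
  filterI_ex (filterI (toq0 f (x n) fc) (toq0 f (x' n) fc)) (Ugt n).
have [_ /le_lt_trans/(_ nd)mnd] := qC m n mn.
move: m1 m2 n1 n2 n3 n4 p1 p2 pn => /=; rewrite !mulg1.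
have := dist_move (f (q p * x n)%g) (f (q p * x' n)%g)
  (f (q0 * x n)%g) (f (q0 * x' n)%g).
have := dist_move (f (q0 * x n)%g) (f (q0 * x' n)%g) (phi q0) (phi' q0).
have := dist_move (phi q0) (phi' q0) (phi (q m)) (phi' (q m)).
have := dist_move (phi (q m)) (phi' (q m))
  (f (q m * x n)%g) (f (q m * x' n)%g).
rewrite (distC (f (q0 * x' n)%g) (f (q p * x' n)%g)).
rewrite (distC (phi' q0) (f _)) (distC (phi q0) (phi (q m))).
rewrite (distC (phi (q m)) (f _)).
by move: mnd; rewrite /d; lra.
Qed.

(** If the translates of [f] oscillated on every open set, then points [q_n] of
    a compact set and pairs [x_n, x'_n] could be chosen one after the other
    such that [f (. x_n)], [f (. x'_n)] nearly agree at the earlier [q_i] and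
    differ at all the later [q_m]. Indeed [f (. x_n)] oscillates between
    two points of a small open set, total boundedness replaces [x_n] by
    an [x'_n] from a finite set, for which the oscillation is small, so that
    they differ at one of the two points; this is [q_n], and the later [q_m]
    are kept in the open set where they differ. *)
Lemma small_oscillation f e :
  locally_compact [set: G] -> ultra_aaL f -> 0 < e ->
  exists x U, nbhs x U /\ forall y z t, U y -> U z ->
    dist (f (y * t)%g) (f (z * t)%g) <= e.
Proof.
move=> lcG fa e0; apply: contrapT => osc.
have wild x U : nbhs x U -> exists y z t,
    [/\ U y, U z & e < dist (f (y * t)%g) (f (z * t)%g)].
  move=> xU; apply: contrapT => tame; apply: osc; exists x, U; split=> //.
  move=> y z t Uy Uz; rewrite leNgt; apply/negP => big.
  by apply: tame; exists y, z, t.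
have [C C1 [cC _]] := lcG 1%g I.
have {}C1 : nbhs (1%g : G) C.
  by move: C1; rewrite /within /=; apply: filterS => x; apply.
have fc := ultra_aaL_continuous fa.
have e4 : 0 < e / 4 by lra.
have e8 : 0 < e / 8 by lra.
have cf g t : (fun y => f (y * t)%g) @ g --> f (g * t)%g.
  have yt : (fun y => y * t)%g @ g --> (g * t)%g.
    by apply: cvgMg; [exact: cvg_id|exact: cvg_cstg].
  exact: (continuous_cvg _ (fc _) yt).
pose D (l : seq (G * (G * G))) : set G := [set g | C g /\ forall p, p \in l ->
  e / 4 < dist (f (g * p.2.1)%g) (f (g * p.2.2)%g)].
have [u u_spec] : exists u : nat -> G * (G * G), forall i n, (i < n)%N ->
    [/\ C (u n).1,
      dist (f ((u i).1 * (u n).2.1)%g) (f ((u i).1 * (u n).2.2)%g) <= n.+1%:R^-1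
      & e / 4 < dist (f ((u n).1 * (u i).2.1)%g) (f ((u n).1 * (u i).2.2)%g)].
  apply: (@history_sequence (G * (G * G))%type
    (fun l => exists g : G, nbhs g (D l))
    (fun n b a => [/\ C a.1,
      dist (f (b.1 * a.2.1)%g) (f (b.1 * a.2.2)%g) <= n.+1%:R^-1 &
      e / 4 < dist (f (a.1 * b.2.1)%g) (f (a.1 * b.2.2)%g)])).
    by exists 1%g; apply: filterS C1 => x Cx; split.
  move=> l [g gD].
  have n0 : 0 < (size l).+1%:R^-1 :> R by rewrite invr_gt0 ltr0n.
  have [k kP] := ultra_aaL_totally_bounded [seq p.1 | p <- l] fa n0.
  have gk : \forall y \near g, forall t, t \in k ->
      dist (f (y * t)%g) (f (g * t)%g) < e / 8.
    by apply: near_seq => t _; have /cvg_dist/(_ _ e8) := cf g t.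
  have [y [z [x [[Dy yk] [Dz zk] yzx]]]] :=
    wild _ _ (filterI (nbhs_interior gD) gk).
  have [x' x'k xx'] := kP x.
  have [q [Dq qxx']] : exists q, (D l)^° q /\
      e / 4 < dist (f (q * x)%g) (f (q * x')%g).
    have [yx|yx] := ltP (e / 4) (dist (f (y * x)%g) (f (y * x')%g)).
      by exists y.
    exists z; split=> //; have := yk x' x'k; have := zk x' x'k.
    have := dist_move (f (y * x)%g) (f (z * x)%g) (f (y * x')%g) (f (z * x')%g).
    have := dist_tri (f (g * x')%g) (f (y * x')%g) (f (z * x')%g).
    rewrite (distC (f (g * x')%g)) (distC (f (z * x')%g) (f (z * x)%g)); lra.
  have [Cq ql] := interior_subset Dq.
  exists (q, (x, x')) => [b bl|].
    by split=> //; [apply: xx'; exact: map_f|exact: ql].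
  exists q; pose d := dist (f (q * x)%g) (f (q * x')%g) - e / 4.
  have d2 : 0 < d / 2 by rewrite /d; lra.
  have qx t : \forall h \near q, dist (f (h * t)%g) (f (q * t)%g) < d / 2.
    by have /cvg_dist/(_ _ d2) := cf q t.
  have {}Dq : nbhs q (D l) := Dq.
  apply: filterS3 (qx x) (qx x') Dq => h hx hx' [Ch hl]; split=> // p.
  rewrite in_cons => /orP[/eqP-> /=|/hl//].
  have := dist_move (f (q * x)%g) (f (q * x')%g) (f (h * x)%g) (f (h * x')%g).
  rewrite (distC (f (q * x)%g) (f (h * x)%g)); move: hx hx' => /=.
  rewrite /d; lra.
apply: (@double_limit f C (fun n => (u n).1) (fun n => (u n).2.1)
  (fun n => (u n).2.2) (e / 4) fa cC e4) => i n /u_spec[] //.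
Qed.

(** Translating the second argument carries a small oscillation near one point
    to every other point. *)
Lemma ultra_aaL_left_uniform f :
  locally_compact [set: G] -> ultra_aaL f -> left_uniform f.
Proof.
move=> lcG fa x e e0; have [g [U [gU fU]]] := small_oscillation lcG fa e0.
have yg : (fun y => y * (x^-1 * g))%g @ x --> (x * (x^-1 * g))%g.
  by apply: cvgMg; [exact: cvg_id|exact: cvg_cstg].
have {}yg : \forall y \near x, U (y * (x^-1 * g))%g.
  by apply: yg; rewrite mulVKg.
apply: filterS yg => y Uy z.
have := fU _ _ (g^-1 * x * z)%g Uy (nbhs_singleton gU).
by rewrite !mulgA mulgK mulgVK mulgV mul1g.
Qed.

End JointContinuity.

(** * Nets and the supremum norm *)

Section Supnorm.
Context {R : realType} {G : topologicalGroupType}.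
Implicit Types (f : G -> cplx R) (e M : R).

Lemma supnorm_cvg (T : Type) (F : set_system T) {FF : Filter F}
    (g : T -> G -> cplx R) :
  (fun n => supnorm (g n)) @ F --> 0%E <->
  forall e, 0 < e -> \forall n \near F, forall x, Normc.normc (g n x) <= e.
Proof.
have ge_sup h x : ((Normc.normc (h x))%:E <= @supnorm R G h)%E.
  by apply: ereal_sup_ubound; exists x.
have sup_ge0 h : (0 <= @supnorm R G h)%E.
  apply: le_trans (ge_sup h 1%g); rewrite lee_fin -[h _]subr0; exact: dist_ge0.
split=> [/fine_cvgP[gfin /cvgrPdist_le g0] e e0|ge].
  apply: filterS2 gfin (g0 e e0) => n nfin; rewrite sub0r normrN => ne x.
  by rewrite -lee_fin (le_trans (ge_sup _ x))// -(fineK nfin) lee_fin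
    (le_trans (ler_norm _)).
have sup_le e : 0 < e -> \forall n \near F, (supnorm (g n) <= e%:E)%E.
  move=> /ge; apply: filterS => n ne; apply: ge_ereal_sup => _ [x _ <-].
  by rewrite lee_fin.
have fin h e : (supnorm h <= e%:E)%E -> @supnorm R G h \is a fin_num.
  by move=> he; rewrite ge0_fin_numE// (le_lt_trans he)// ltry.
apply/fine_cvgP; split; first by apply: filterS (sup_le 1 ltr01) => n /fin.
apply/cvgrPdist_le => e e0; apply: filterS (sup_le e e0) => n ne /=.
rewrite sub0r normrN ger0_norm ?fine_ge0 //.
by rewrite -lee_fin fineK // (fin _ _ ne).
Qed.

Lemma bounded_dist f :
  bounded_fun f <-> exists M, forall x, dist (f x) 0 <= M.
Proof.
have PG := globally_properfilter (I : [set: G] 1%g).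
rewrite /bounded_fun ex_bound; split=> -[M fM].
  exists (complex.Re M) => x; have /= := fM x I.
  by rewrite -[f x]subr0 normr_dist subr0 lecE /= => /andP[].
by exists M%:C => x _ /=; rewrite -[f x]subr0 normr_dist lecR.
Qed.

Lemma nets_near (T : topologicalType) (x : T) (P : T -> Prop) :
  (forall (D : directedSet) (t : D -> T), t @ tails D --> x ->
    \forall d \near tails D, P (t d)) <-> \forall y \near x, P y.
Proof.
split=> [netP|nP D t tx]; last exact: tx nP.
have FF : ProperFilter (nbhs x) by typeclasses eauto.
pose net := @filter_net T (nbhs x) FF.
pose val : net -> T := @filter_net_val T (nbhs x) FF.
have valE : val @ tails net = nbhs x by exact: filter_net_cvg.
have valP : (val @ tails net) P.
  by apply: netP => A xA; change ((val @ tails net) A); rewrite valE.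
by rewrite valE in valP.
Qed.

Lemma LUCP f : LUC f <->
  [/\ exists M, forall x, dist (f x) 0 <= M, continuous f & left_uniform f].
Proof.
rewrite /LUC (propext (bounded_dist f)); split=> -[fb fc fu]; split=> //.
  move=> x e e0; apply/nets_near => D t tx.
  by have /supnorm_cvg/(_ e e0) := fu D t x tx.
move=> D t t0 tt0; apply/supnorm_cvg => e e0; exact: tt0 (fu t0 e e0).
Qed.

Lemma RUCP f : RUC f <->
  [/\ exists M, forall x, dist (f x) 0 <= M, continuous f &
    left_uniform (f \o monoid.inv)].
Proof.
rewrite /RUC (propext (bounded_dist f)); split=> -[fb fc fu]; split=> //.
  move=> x e e0.
  have fxV : \forall y \near x^-1%g, forall z,
      dist (f (z * y)%g) (f (z * x^-1)%g) <= e.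
    apply/nets_near => D t tx.
    by have /supnorm_cvg/(_ e e0) := fu D t _ tx.
  have {}fxV : \forall y \near x, forall z,
      dist (f (z * y^-1)%g) (f (z * x^-1)%g) <= e := @invg_continuous G x _ fxV.
  apply: filterS fxV => y Hy z /=.
  by rewrite !invgM; exact: Hy.
move=> D t t0 tt0; apply/supnorm_cvg => e e0.
apply: filterS (left_uniform_cvg fu (cvgVg tt0) e0) => n Hn x.
by have := Hn x^-1%g; rewrite /= !invgM !invgK.
Qed.

End Supnorm.

(** * The equivalence *)

Theorem theorem6p4p6 (R : realType) (G : topologicalGroupType)
    (hausG : hausdorff_space G) (lcG : locally_compact [set: G])
    (f : G -> cplx R) :
  bohr_aa f <-> bochner_aa f.
Proof.
rewrite /bochner_aa (propext (bochner_aaR_inv f)).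
rewrite (propext (bochner_aaLP f)) (propext (bochner_aaLP _)).
split=> [fB|[fl fr]].
- have [_ [/LUCP[[M fM] _ fu] /RUCP[_ _ fuV]]] := fB.
  have fd := bohr_returns_divide fB fu fuV.
  have fp := bohr_returns_precompact fB fu fuV.
  split; first exact: precompact_ultra_aaL fM fu fd fp.
  apply: (@precompact_ultra_aaL _ _ _ M) => [x|//|s t e e0|V].
  + exact: fM.
  + have [W fW Wd] := fd t^-1%g s^-1%g e e0.
    exists W; first by rewrite returns_inv.
    by move=> x y Wx Wy; have := Wd y x Wy Wx; rewrite /= !invgM !invgK !mulgA.
  + by rewrite returns_inv; exact: fp.
- have fb := ultra_aaL_bounded fl; have fc := ultra_aaL_continuous fl.
  apply: returns_bohr; first exact: bochner_returns_divide.
    exact: bochner_returns_precompact.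
  split; first by apply/LUCP; split=> //; exact: ultra_aaL_left_uniform.
  by apply/RUCP; split=> //; exact: ultra_aaL_left_uniform.
Qed.
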